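(* Let $B, C\in\mathbb{F}_2^{\mathbb{N}\times\mathbb{N}}$. Then the following are equivalent. (i) $(B,C)$ generates a digital $(0,2)$-sequence in base $2$. (ii) There exist $L_1,L_2\in\mathcal{L}_\infty$ and $U\in\mathcal{U}_\infty$ such that $B=L_1U$ and $C=L_2P_\infty U$.
   Context: $\mathbb{N}$ is the set of positive integers, $\mathbb{F}_2=\{0,1\}$ the field with two elements, and $\mathbb{F}_2^{\mathbb{N}\times\mathbb{N}}$ the set of infinite matrices over $\mathbb{F}_2$ indexed by $\mathbb{N}\times\mathbb{N}$. $\mathcal{L}_\infty$ (resp. $\mathcal{U}_\infty$) is the set of non-singular lower- (resp. upper-) triangular infinite matrices over $\mathbb{F}_2$, i.e. those triangular matrices whose diagonal entries are all $1$. $P_\infty=\left(\binom{j-1}{i-1}\right)_{i,j\ge1}$ modulo $2$ is the infinite upper-triangular Pascal matrix. For $C\in\mathbb{F}_2^{\mathbb{N}\times\mathbb{N}}$, $L\in\mathcal{L}_\infty$, $U\in\mathcal{U}_\infty$ the products $LC$ and $CU$ are well defined (each entry is a finite sum) and $(LC)U=L(CU)$. Digital sequence: for a nonnegative integer $n$ write $n=\sum_{i\ge1} z_i(n)2^{i-1}$ with $z_i(n)\in\{0,1\}$ (almost all zero). Define $\phi_\infty:\mathbb{F}_2^{\mathbb{N}}\to[0,1]$ by $\phi_\infty((y_1,y_2,\dots)^\top)=\sum_{i\ge1}y_i2^{-i}$ (identifying elements of $\mathbb{F}_2$ with the integers $0,1$). For $C_1,\dots,C_s\in\mathbb{F}_2^{\mathbb{N}\times\mathbb{N}}$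 put $\boldsymbol{y}_{n,j}=C_j\cdot(z_1(n),z_2(n),\dots)^\top\in\mathbb{F}_2^{\mathbb{N}}$ and $\boldsymbol{x}_n=(\phi_\infty(\boldsymbol{y}_{n,1}),\dots,\phi_\infty(\boldsymbol{y}_{n,s}))\in[0,1]^s$ for $n\ge0$. The digital sequence generated by $(C_1,\dots,C_s)$ is $\{\boldsymbol{x}_0,\boldsymbol{x}_1,\dots\}$; the prescribed $2$-adic expansion of the $j$-th coordinate of $\boldsymbol{x}_n$ is the one with digit vector $\boldsymbol{y}_{n,j}$ (expansions with almost all digits equal to $1$ are allowed). $(t,m,s)$-net: $2^m$ points in $[0,1)^s$ (counted with multiplicity) form a $(t,m,s)$-net in base $2$ if every interval of the form $\prod_{i=1}^s[a_i/2^{c_i},(a_i+1)/2^{c_i})$ with integers $c_i\ge0$, $0\le a_i<2^{c_i}$, and of volume $2^{t-m}$ contains exactly $2^t$ of the points. $(t,s)$-sequence: for $x\in[0,1]$ with prescribed $2$-adic expansion $x=\sum_{i\ge1}x_i2^{-i}$ let $[x]_m=\sum_{i=1}^m x_i2^{-i}$, and apply $[\cdot]_m$ coordinatewise to points of $[0,1]^s$. A sequence $\boldsymbol{x}_0,\boldsymbol{x}_1,\dots$ in $[0,1]^s$ with prescribed $2$-adic expansions is a $(t,s)$-sequence in base $2$ if for all nonnegative integers $k$ and $m$ the points $[\boldsymbol{x}_{k2^m}]_m,\dots,[\boldsymbol{x}_{(k+1)2^m-1}]_m$ form a $(t,m,s)$-net in base $2$. ''$(C_1,\dots,C_s)$ generates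 a digital $(t,s)$-sequence in base $2$'' means that the digital sequence generated by $(C_1,\dots,C_s)$ is a $(t,s)$-sequence in base $2$. *)

(* Defs.v *)
From HB Require Import structures.
From mathcomp Require Import all_boot all_order all_algebra.
From mathcomp Require Import all_classical all_reals all_analysis.
Set Implicit Arguments.
Unset Strict Implicit.
Unset Printing Implicit Defensive.
Import Order.TTheory GRing.Theory Num.Theory.
Import numFieldNormedType.Exports.
Local Open Scope classical_set_scope.
Local Open Scope ring_scope.

(* Matrices and vectors over F_2 indexed by the positive integers; indices are
   shifted to start from 0, so [A i j] is the entry in row i+1, column j+1. *)
Definition infvec := nat -> 'F_2.
Definition infmx := nat -> nat -> 'F_2.

(* [\sum_(k \in A) _] adds the nonzero terms when there are finitely many of
   them; this is the case for L C (L lower triangular), C U (U upper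
   triangular), and C y (y almost everywhere zero). *)
Definition infmul (A B : infmx) : infmx :=
  fun i j => \sum_(k \in [set: nat]) A i k * B k j.

Definition infmulv (A : infmx) (y : infvec) : infvec :=
  fun i => \sum_(k \in [set: nat]) A i k * y k.

Definition lower_infty : set infmx :=
  [set L | (forall i j : nat, (i < j)%N -> L i j = 0) /\
           (forall i : nat, L i i = 1)].

Definition upper_infty : set infmx :=
  [set U | (forall i j : nat, (j < i)%N -> U i j = 0) /\
           (forall i : nat, U i i = 1)].

Definition pascal_infty : infmx := fun i j => ('C(j, i))%:R.

Definition bits (n : nat) : infvec := fun i => (odd (n %/ 2 ^ i))%:R.

Section Points.
Variable R : realType.

(* The coercion 'F_2 -> nat sends 0, 1 to the integers 0, 1. *)
Definition phi_infty (y : infvec) : R :=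
  limn (series (fun i => (y i : nat)%:R / 2 ^+ i.+1) : R^nat).

(* [x]_m for the point x with prescribed digit vector y *)
Definition trunc (m : nat) (y : infvec) : R :=
  \sum_(i < m) (y i : nat)%:R / 2 ^+ i.+1.

Definition is_net (t m s : nat) (P : 'I_(2 ^ m) -> 'I_s -> R) : Prop :=
  (forall p j, 0 <= P p j < 1) /\
  forall c a : 'I_s -> nat,
    (forall j, (a j < 2 ^ c j)%N) ->
    \prod_(j < s) (2 ^+ c j)^-1 = 2 ^ (t%:Z - m%:Z) :> R ->
    #|[set p | [forall j, (a j)%:R / 2 ^+ c j <= P p j
                            < (a j).+1%:R / 2 ^+ c j]]%SET| = (2 ^ t)%N.

(* x n j is the j-th coordinate of the n-th point of the sequence, and y n j
   the digit vector of its prescribed 2-adic expansion. *)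
Definition is_ts_sequence (t s : nat)
    (x : nat -> 'I_s -> R) (y : nat -> 'I_s -> infvec) : Prop :=
  (forall n j, x n j = phi_infty (y n j)) /\
  forall k m : nat,
    is_net t (fun (p : 'I_(2 ^ m)) j => trunc m (y (k * 2 ^ m + p)%N j)).

Definition digital_digits (s : nat) (C : s.-tuple infmx) :
    nat -> 'I_s -> infvec :=
  fun n j => infmulv (tnth C j) (bits n).

Definition digital_sequence (s : nat) (C : s.-tuple infmx) :
    nat -> 'I_s -> R :=
  fun n j => phi_infty (digital_digits C n j).

Definition generates_digital_sequence (t s : nat) (C : s.-tuple infmx) : Prop :=
  is_ts_sequence t (digital_sequence C) (digital_digits C).

End Points.

(* Main.v *)
Require Import Defs.
From mathcomp Require Import all_boot all_order all_algebra.
From mathcomp Require Import all_classical all_reals all_analysis.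
From mathcomp Require Import zify.
Set Implicit Arguments.
Unset Strict Implicit.
Unset Printing Implicit Defensive.
Import Order.TTheory GRing.Theory Num.Theory.
Local Open Scope ring_scope.

(* The net property says that, for c1 + c2 = m, the first c1 rows of B stacked on
   the first c2 rows of C and cut at column m form a nonsingular matrix. With
   c2 = 0 this yields an LU decomposition B = L1 U, and one passes to
   C' = C U^-1. Let D f n = f n + f (n + 1) be the difference operator over F_2
   and f_c the row c of C'. Testing the condition on the vector with entries
   binom(c, k) in the columns n + k gives D^c f_c = 1 inductively: D^c kills the
   rows before c, so it cannot vanish on f_c, and the only nonzero value is 1.
   Newton's expansion of the rows then says exactly that C' = L2 P.
   Conversely, after cancelling the triangular factors, the condition says that
   the windows of consecutive columns in the first rows of P are nonsingular. *)

(** * Arithmetic in F_2 and products with finitely supported vectors *)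

Lemma F2_addrr (x : 'F_2) : x + x = 0.
Proof. by rewrite -mulr2n -mulr_natr pchar_Fp_0 ?mulr0. Qed.

Lemma F2_oppr (x : 'F_2) : - x = x.
Proof. by apply/eqP; rewrite eq_sym -addr_eq0 F2_addrr. Qed.

Lemma F2_neq0 (x : 'F_2) : x <> 0 -> x = 1.
Proof.
move=> x0; apply/val_inj; case: x x0 => [[|[|//]] lt] //= x0.
by case: x0; apply/val_inj.
Qed.

(** Finite support turns [infmulv] into an ordinary finite sum for any matrix; binary digit vectors
    and columns of upper triangular matrices have it. *)
Definition supported (m : nat) (y : infvec) : Prop :=
  forall k : nat, (m <= k)%N -> y k = 0.

Lemma infmulvE (m : nat) (A : infmx) (y : infvec) (i : nat) :
  (forall k : nat, (m <= k)%N -> A i k * y k = 0) ->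
  infmulv A y i = \sum_(k < m) A i k * y k.
Proof.
move=> Ay0; rewrite /infmulv (fsbig_ord _ _ (fun k => A i k * y k)).
apply/esym/fsbig_widen => // k [_ /= km]; apply: Ay0.
by rewrite leqNgt; apply/negP.
Qed.

Lemma infmulv_supported (m : nat) (A : infmx) (y : infvec) (i : nat) :
  supported m y -> infmulv A y i = \sum_(k < m) A i k * y k.
Proof. by move=> my; apply: infmulvE => k /my ->; rewrite mulr0. Qed.

Lemma infmulv_lower (L : infmx) (y : infvec) (i : nat) :
  lower_infty L -> infmulv L y i = \sum_(k < i.+1) L i k * y k.
Proof. by move=> [L0 _]; apply: infmulvE => k /L0 ->; rewrite mul0r. Qed.

Lemma upper_supported (U : infmx) (j : nat) :
  upper_infty U -> supported j.+1 (U ^~ j).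
Proof. by move=> [U0 _] k /U0. Qed.

Lemma infmulv_upper_supported (U : infmx) (m : nat) (y : infvec) :
  upper_infty U -> supported m y -> supported m (infmulv U y).
Proof.
move=> [U0 _] my i mi; rewrite (infmulv_supported _ _ my) big1 // => k _.
by rewrite U0 ?mul0r // (leq_trans (ltn_ord k)).
Qed.

Lemma infmulv_upper_last (U : infmx) (m : nat) (y : infvec) :
  upper_infty U -> supported m.+1 y -> infmulv U y m = y m.
Proof.
move=> [U0 U1] my; rewrite (infmulv_supported _ _ my) big_ord_recr /= U1 mul1r.
by rewrite big1 ?add0r // => k _; rewrite U0 ?mul0r.
Qed.

Lemma infmulvD (A : infmx) (m : nat) (x y : infvec) :
  supported m x -> supported m y ->
  infmulv A (fun k => x k + y k) =1 (fun i => infmulv A x i + infmulv A y i).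
Proof.
move=> mx my i; rewrite (infmulv_supported _ _ mx) (infmulv_supported _ _ my).
rewrite (infmulv_supported (m := m)) => [|k mk]; last by rewrite mx ?my ?addr0.
by rewrite -big_split; apply: eq_bigr => k _; rewrite mulrDr.
Qed.

(** [U] keeps the support below [m], so both sides are finite double sums, whatever [A] is. *)
Lemma infmulvA_upper (A U : infmx) (m : nat) (y : infvec) :
  upper_infty U -> supported m y ->
  infmulv (infmul A U) y = infmulv A (infmulv U y).
Proof.
move=> Uu my; apply/funext => i; rewrite (infmulv_supported _ _ my).
rewrite (infmulv_supported _ _ (infmulv_upper_supported Uu my)).
under [RHS]eq_bigr => k _ do rewrite (infmulv_supported _ _ my) mulr_sumr.
rewrite exchange_big; apply: eq_bigr => j _ /=.
rewrite [infmul _ _ _ _](@infmulv_supported m A (U ^~ j)); last first.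
  by move=> k mk; apply: upper_supported => //; apply: leq_trans mk.
by rewrite mulr_suml; apply: eq_bigr => k _; rewrite mulrA.
Qed.

Lemma infmulvA_lower (L A : infmx) (m : nat) (y : infvec) :
  lower_infty L -> supported m y ->
  infmulv (infmul L A) y = infmulv L (infmulv A y).
Proof.
move=> Ll my; apply/funext => i; rewrite (infmulv_supported _ _ my).
rewrite infmulv_lower //.
under [RHS]eq_bigr => k _ do rewrite (infmulv_supported _ _ my) mulr_sumr.
rewrite exchange_big; apply: eq_bigr => j _ /=.
rewrite [infmul _ _ _ _](infmulv_lower (A ^~ j)) //.
by rewrite mulr_suml; apply: eq_bigr => k _; rewrite mulrA.
Qed.

Lemma infmulA_upper (A V U : infmx) :
  upper_infty V -> upper_infty U ->
  infmul (infmul A V) U = infmul A (infmul V U).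
Proof.
move=> Vu Uu; apply/funext => i; apply/funext => j.
by rewrite [LHS](congr1 (@^~ i) (infmulvA_upper A Vu (upper_supported (j := j) Uu))).
Qed.

Lemma lower_kernel (L : infmx) (c : nat) (y : infvec) :
  lower_infty L -> (forall i, (i < c)%N -> infmulv L y i = 0) ->
  forall i, (i < c)%N -> y i = 0.
Proof.
move=> Ll Ly0; elim/ltn_ind => i IH ic.
have := Ly0 i ic; rewrite infmulv_lower // big_ord_recr /= big1 => [|k _].
  by rewrite add0r Ll.2 mul1r.
by rewrite IH ?mulr0 // (ltn_trans (ltn_ord k)).
Qed.

Lemma infmulv_lower_eq0 (L : infmx) (c : nat) (y : infvec) :
  lower_infty L -> (forall i, (i < c)%N -> y i = 0) ->
  forall i, (i < c)%N -> infmulv L y i = 0.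
Proof.
move=> Ll y0 i ic; rewrite infmulv_lower // big1 // => k _.
by rewrite y0 ?mulr0 // (leq_trans (ltn_ord k)).
Qed.

(** Back substitution: the last entry passes through [U] unchanged, so it vanishes and the support
    shrinks by one. *)
Lemma upper_kernel (U : infmx) (m : nat) (y : infvec) :
  upper_infty U -> supported m y ->
  (forall i, (i < m)%N -> infmulv U y i = 0) -> forall k, y k = 0.
Proof.
move=> Uu; elim: m => [|m IH] my Uy0 k; first exact: my.
have ym : y m = 0 by rewrite -(infmulv_upper_last Uu my) Uy0.
apply: IH => [k' | i im]; last by rewrite Uy0 // ltnW.
by rewrite leq_eqVlt => /orP[/eqP <- | /my].
Qed.

(** * Regular pairs, finite linear systems and LU decomposition *)

(* [(B, C)] is regular when, for all [c1 + c2 = m], stacking the first [c1] rows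
   of [B] and the first [c2] rows of [C], cut at column [m], gives a nonsingular
   matrix. *)
Definition regular_pair (B C : infmx) : Prop :=
  forall (c1 c2 : nat) (v : infvec), supported (c1 + c2) v ->
    (forall i, (i < c1)%N -> infmulv B v i = 0) ->
    (forall i, (i < c2)%N -> infmulv C v i = 0) -> forall k, v k = 0.

(** The leading [m] by [m] block acts injectively on the finite set of columns of length [m], hence
    bijectively. *)
Lemma injective_solve (A : infmx) (m : nat) (b : infvec) :
  (forall v, supported m v -> (forall i, (i < m)%N -> infmulv A v i = 0) ->
     forall k, v k = 0) ->
  exists2 v, supported m v & forall i, (i < m)%N -> infmulv A v i = b i.
Proof.
move=> kerA; pose M : 'M['F_2]_m := \matrix_(i, j) A i j.
pose vec (x : 'cV['F_2]_m) : infvec :=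
  fun k => if insub k is Some i then x i ord0 else 0.
have vecE x (i : 'I_m) : vec x i = x i ord0 by rewrite /vec valK.
have vec_supp x : supported m (vec x).
  by move=> k mk; rewrite /vec insubF // ltnNge mk.
have vecM x (i : 'I_m) : infmulv A (vec x) i = (M *m x) i ord0.
  rewrite (infmulv_supported _ _ (vec_supp x)) mxE.
  by apply: eq_bigr => k _; rewrite vecE mxE.
have Minj : injective (mulmx M : 'cV_m -> 'cV_m).
  move=> x y Mxy; apply/eqP; rewrite -subr_eq0; apply/eqP/colP => i.
  rewrite -vecE kerA ?mxE // => j jm; rewrite -[j]/(val (Ordinal jm)) vecM.
  by rewrite mulmxBr Mxy subrr mxE.
have [N _ MK] := injF_bij Minj.
exists (vec (N (\col_i b i))) => // i im.
by rewrite -[i]/(val (Ordinal im)) vecM MK mxE.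
Qed.

(** Column [j] of the inverse solves [V u = e_j] in the rows up to [j]; row [j] reads off the last
    entry of [u], which is therefore 1. *)
Lemma upper_inverse (V : infmx) : upper_infty V ->
  exists2 U, upper_infty U & infmul V U = fun i j => (i == j)%:R.
Proof.
move=> Vu.
have /choice[W W_P] j : exists u, supported j.+1 u /\
    forall i, (i < j.+1)%N -> infmulv V u i = (i == j)%:R.
  have [|u] := @injective_solve V j.+1 (fun i => (i == j)%:R); last by exists u.
  by move=> v; apply: upper_kernel.
exists (fun i j => W j i).
  split=> [i j ji | i]; first exact: (W_P j).1.
  rewrite -(infmulv_upper_last Vu (W_P i).1) (W_P i).2 //.
  by rewrite eqxx.
apply/funext => i; apply/funext => j.
have [ij|ji] := ltnP i j.+1; first exact: (W_P j).2.
by rewrite gtn_eqF //; apply: infmulv_upper_supported (W_P j).1 _ ji.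
Qed.

Lemma infmul1 (A : infmx) : infmul A (fun i j => (i == j)%:R) = A.
Proof.
apply/funext => i; apply/funext => j.
rewrite [LHS](@infmulv_supported j.+1 A (fun k => (k == j)%:R)).
  rewrite big_ord_recr /= eqxx mulr1 big1 ?add0r // => k _.
  by rewrite ltn_eqF ?mulr0.
by move=> k jk; rewrite gtn_eqF.
Qed.

(* The columns of the inverse [V] of the right factor of an LU decomposition
   solve [B v = e_m] in the first [m + 1] rows. *)
Lemma leading_LU (B : infmx) :
  (forall m v, supported m v -> (forall i, (i < m)%N -> infmulv B v i = 0) ->
     forall k, v k = 0) ->
  exists V, upper_infty V /\ lower_infty (infmul B V).
Proof.
move=> kerB.
have /choice[W W_P] j : exists v, supported j.+1 v /\
    forall i, (i < j.+1)%N -> infmulv B v i = (i == j)%:R.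
  have [|v] := @injective_solve B j.+1 (fun i => (i == j)%:R); last by exists v.
  exact: kerB.
exists (fun i j => W j i); split; split=> [i j ij | i].
- exact: (W_P j).1.
(* With diagonal entry 0, column [i] would be supported below [i] and killed by the first [i] rows
   of [B], hence zero; but row [i] takes the value 1 on it. *)
- apply: F2_neq0 => Wi0.
  have Wsupp : supported i (W i).
    by move=> k; rewrite leq_eqVlt => /orP[/eqP <-//|]; apply: (W_P i).1.
  have W0 : forall k, W i k = 0.
    by apply: kerB Wsupp _ => k ki; rewrite ((W_P i).2 k (ltnW ki)) ltn_eqF.
  have := (W_P i).2 i (ltnSn i); rewrite eqxx (infmulv_supported _ _ Wsupp).
  rewrite big1 => [|k _]; first by move/esym/eqP; rewrite oner_eq0.
  by rewrite W0 mulr0.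
- by rewrite [LHS](W_P j).2 ?ltn_eqF // ltnW.
- by rewrite [LHS](W_P i).2 // eqxx.
Qed.

(** * Iterated differences and the Pascal matrix *)

(** Each of the [n] steps either keeps [k] or raises it by one, and binom(n, i) counts the ways to
    raise it [i] times. *)
Lemma pascal_array (V : zmodType) (g : nat -> nat -> V) :
  (forall k n, g k n.+1 = g k n + g k.+1 n) ->
  forall n k, g k n = \sum_(i < n.+1) g (k + i)%N 0%N *+ 'C(n, i).
Proof.
move=> gS; elim=> [|n IH] k; first by rewrite big_ord1 addn0 bin0.
rewrite gS !IH [RHS]big_ord_recl.
under [X in _ = _ + X]eq_bigr => i _.
  rewrite lift0 binS mulrnDr addnS -addSn; over.
rewrite big_split /= addrA; congr (_ + _).
transitivity (\sum_(i < n.+2) g (k + i)%N 0%N *+ 'C(n, i)).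
  by rewrite [RHS]big_ord_recr /= bin_small // mulr0n addr0.
rewrite big_ord_recl !bin0; congr (_ + _).
by apply: eq_bigr => i _; rewrite lift0 addnS -addSn.
Qed.

Definition diff2 (c : nat) (f : infvec) : infvec :=
  iter c (fun f n => f n + f n.+1) f.

Lemma diff2S (c : nat) (f : infvec) (n : nat) :
  diff2 c.+1 f n = diff2 c f n + diff2 c f n.+1.
Proof. by []. Qed.

Lemma diff2_expand (c : nat) (f : infvec) (a : nat) :
  diff2 c f a = \sum_(k < c.+1) f (a + k)%N *+ 'C(c, k).
Proof.
rewrite -[in LHS](addn0 a).
apply: (@pascal_array _ (fun k n => diff2 n f (a + k)%N) _ c 0%N) => k n.
by rewrite diff2S addnS.
Qed.

(** Newton's forward difference formula. The array is the transpose of the one in [diff2_expand];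
    its rule f(n + 1) = f(n) + D f(n) uses characteristic 2. *)
Lemma diff2_newton (f : infvec) (n : nat) :
  f n = \sum_(i < n.+1) diff2 i f 0 *+ 'C(n, i).
Proof.
apply: (@pascal_array _ (fun k n => diff2 k f n) _ n 0%N) => k m.
by rewrite diff2S addrA F2_addrr add0r.
Qed.

Lemma diff2_eq0 (f : infvec) (c : nat) :
  (forall n, diff2 c f n = 1) -> forall d n, (c < d)%N -> diff2 d f n = 0.
Proof.
move=> f1; elim=> [//|d IH] n; rewrite ltnS leq_eqVlt diff2S => /orP[/eqP <-|cd].
  by rewrite !f1 F2_addrr.
by rewrite !IH // addr0.
Qed.

(** The Newton coefficients of row [c] form row [c] of [L]: the [c]-th difference gives the diagonal
    1, and the higher differences of a constant vanish. *)
Lemma lower_pascal (C : infmx) :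
  (forall c n, diff2 c (C c) n = 1) ->
  exists2 L, lower_infty L & C = infmul L pascal_infty.
Proof.
move=> C1; exists (fun c i => diff2 i (C c) 0).
  by split=> [i j ij | i]; [apply: diff2_eq0 ij | apply: C1].
apply/funext => c; apply/funext => n.
rewrite [RHS](@infmulv_supported n.+1 _ (pascal_infty ^~ n)) => [|k nk].
  by rewrite [LHS]diff2_newton; apply: eq_bigr => i _; rewrite mulr_natr.
by rewrite /pascal_infty bin_small.
Qed.

Lemma pascal_upper : upper_infty pascal_infty.
Proof. by split=> [i j ji | i]; rewrite /pascal_infty ?binn ?bin_small. Qed.

(* Shifting [v] by one column changes row [i] of [P v] by row [i - 1], so one
   may assume [c1 = 0], where the matrix is triangular. *)
Lemma pascal_window (c1 c2 : nat) (v : infvec) :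
  supported (c1 + c2) v -> (forall i, (i < c1)%N -> v i = 0) ->
  (forall i, (i < c2)%N -> infmulv pascal_infty v i = 0) -> forall k, v k = 0.
Proof.
elim: c1 v => [|c1 IH] v v_supp v0 Pv0.
  exact: upper_kernel pascal_upper v_supp Pv0.
pose w k := v k.+1.
have w_supp : supported (c1 + c2) w by move=> k ck; apply: v_supp.
have vw i : infmulv pascal_infty v i =
    \sum_(k < c1 + c2) ('C(k.+1, i))%:R * w k.
  by rewrite (infmulv_supported _ _ v_supp) big_ord_recl v0 // mulr0 add0r.
suff w0 : forall k, w k = 0 by case=> [|k]; [apply: v0 | apply: w0].
apply: IH => // [i ic|]; first exact: v0.
elim=> [|i IHi] ic.
  rewrite -(Pv0 0%N ic) vw (infmulv_supported _ _ w_supp).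
  by apply: eq_bigr => k _; rewrite /pascal_infty !bin0.
have := Pv0 _ ic; rewrite vw.
under eq_bigr => k _ do rewrite binS natrD mulrDl.
by rewrite big_split /= -!(infmulv_supported pascal_infty _ w_supp)
  (IHi (ltnW ic)) addr0.
Qed.

(** * Regularity and the triangular factorization *)

(** A lower triangular left factor does not change when the first rows vanish, and [U] preserves the
    support, so [pascal_window] applies to [U v]. *)
Lemma regular_of_factors (L1 L2 U : infmx) :
  lower_infty L1 -> lower_infty L2 -> upper_infty U ->
  regular_pair (infmul L1 U) (infmul (infmul L2 pascal_infty) U).
Proof.
move=> L1l L2l Uu c1 c2 v v_supp.
rewrite (infmulvA_lower U L1l v_supp) (infmulvA_upper _ Uu v_supp).
have Uv_supp := infmulv_upper_supported Uu v_supp.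
rewrite (infmulvA_lower _ L2l Uv_supp) => /(lower_kernel L1l) Uv0.
move=> /(lower_kernel L2l) PUv0.
have {PUv0}Uv0 := pascal_window Uv_supp Uv0 PUv0.
by apply: upper_kernel Uu v_supp _ => i _.
Qed.

Lemma factors_of_regular (B C : infmx) : regular_pair B C ->
  exists L1 L2 U : infmx,
    [/\ lower_infty L1, lower_infty L2, upper_infty U,
        B = infmul L1 U & C = infmul (infmul L2 pascal_infty) U].
Proof.
move=> BC; have [|V [Vu BVl]] := @leading_LU B.
  by move=> m v v_supp Bv0; apply: (BC m 0%N) => //; rewrite addn0.
have [U Uu VU] := upper_inverse Vu.
suff /lower_pascal[L2 L2l CV] : forall c n, diff2 c (infmul C V c) n = 1.
  exists (infmul B V), L2, U; split=> //; first by rewrite infmulA_upper // VU infmul1.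
  by rewrite -CV infmulA_upper // VU infmul1.
elim/ltn_ind => c IH n.
(* The coefficients of D^c, placed in the columns [n] to [n + c]: pairing any row of [C V] with [w]
   gives its [c]-th difference at [n]. *)
pose w k : 'F_2 := if (k < n)%N then 0 else ('C(c, k - n))%:R.
have w_supp : supported (n + c.+1) w.
  move=> k ck; rewrite /w ltnNge (leq_trans _ ck) ?leq_addr //=.
  by rewrite bin_small // ltn_subRL -addnS.
have CVw r : infmulv C (infmulv V w) r = diff2 c (infmul C V r) n.
  rewrite -(infmulvA_upper _ Vu w_supp) (infmulv_supported _ _ w_supp).
  rewrite big_split_ord /= big1 => [|k _]; last by rewrite /w ltn_ord mulr0.
  rewrite add0r diff2_expand; apply: eq_bigr => k _.
  by rewrite /w ltnNge leq_addr /= addKn mulr_natr.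
(* Were the value 0, [V w] would be killed by the first [n] rows of [B], since [B V] is lower
   triangular and [w] starts at [n], and by the first [c + 1] rows of [C]. *)
rewrite -CVw; apply: F2_neq0 => CVwc.
have Vw0 : forall k, infmulv V w k = 0.
  apply: (BC n c.+1); first exact: infmulv_upper_supported Vu w_supp.
  - rewrite -(infmulvA_upper _ Vu w_supp).
    by apply: infmulv_lower_eq0 => // i ni; rewrite /w ni.
  - move=> i; rewrite ltnS leq_eqVlt => /orP[/eqP ->|ic]; first exact: CVwc.
    by rewrite CVw (@diff2_eq0 _ i) // => m; apply: IH.
(* The last entry of [V w] is that of [w], namely binom(c, c) = 1. *)
have := Vw0 (n + c)%N; rewrite infmulv_upper_last -?addnS //.
by rewrite /w ltnNge leq_addr /= addKn binn => /eqP; rewrite oner_eq0.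
Qed.

(** * Digit vectors, truncation and dyadic intervals *)

Lemma F2_lt2 (x : 'F_2) : (x < 2)%N.
Proof. exact: ltn_ord. Qed.

(** Horner's scheme with the first digit most significant: the number of the dyadic interval of
    length 2^-c selected by [y]. *)
Fixpoint digits_nat (c : nat) (y : infvec) : nat :=
  if c is c'.+1 then (2 * digits_nat c' y + y c')%N else 0%N.

Lemma digits_nat_lt (c : nat) (y : infvec) : (digits_nat c y < 2 ^ c)%N.
Proof. by elim: c => //= c IH; have := F2_lt2 (y c); rewrite expnS /=; lia. Qed.

Lemma digits_nat_inj (c : nat) (x y : infvec) :
  digits_nat c x = digits_nat c y -> forall i, (i < c)%N -> x i = y i.
Proof.
elim: c => //= c IH xy i; have := F2_lt2 (x c); have := F2_lt2 (y c).
move=> yc xc; rewrite ltnS leq_eqVlt => /orP[/eqP -> | ic].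
  by apply/val_inj => /=; lia.
by apply: IH => //; lia.
Qed.

Lemma digits_nat_eq0 (c : nat) (y : infvec) :
  (forall i, (i < c)%N -> y i = 0) -> digits_nat c y = 0%N.
Proof.
elim: c => //= c IH y0; rewrite IH ?y0 // => i ic.
by rewrite y0 // ltnW.
Qed.

Lemma digits_nat_div (c d : nat) (y : infvec) :
  (digits_nat (c + d) y %/ 2 ^ d)%N = digits_nat c y.
Proof.
elim: d => [|d IH]; first by rewrite addn0 divn1.
rewrite addnS /= expnS divnMA [(2 * digits_nat _ _)%N]mulnC divnMDl //.
by rewrite [(y _ %/ 2)%N]divn_small ?F2_lt2 // addn0.
Qed.

Lemma truncE (R : realType) (m : nat) (y : infvec) :
  trunc R m y = (digits_nat m y)%:R / 2 ^+ m.
Proof.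
rewrite /trunc; elim: m => [|m IH]; first by rewrite big_ord0 mul0r.
rewrite big_ord_recr /= IH natrD natrM exprS [RHS]mulrDl; congr (_ + _).
by rewrite invfM mulrACA divff ?mul1r // pnatr_eq0.
Qed.

Lemma trunc_bounds (R : realType) (m : nat) (y : infvec) :
  0 <= trunc R m y < 1.
Proof.
rewrite truncE divr_ge0 ?exprn_ge0 //= ltr_pdivrMr ?exprn_gt0 // mul1r.
by rewrite -natrX ltr_nat digits_nat_lt.
Qed.

Lemma trunc_interval (R : realType) (m c a : nat) (y : infvec) : (c <= m)%N ->
  (a%:R / 2 ^+ c <= trunc R m y < a.+1%:R / 2 ^+ c) = (digits_nat c y == a).
Proof.
move=> /subnKC <-; set d := (m - c)%N; rewrite truncE.
rewrite ler_pdivlMr ?exprn_gt0 // ltr_pdivrMr ?exprn_gt0 // exprD.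
rewrite !mulrA !divfK ?expf_neq0 ?pnatr_eq0 //.
rewrite -!natrX -!natrM ler_nat ltr_nat.
by rewrite -leq_divRL ?expn_gt0 // -ltn_divLR ?expn_gt0 // digits_nat_div ltnS
  andbC -eqn_leq.
Qed.

(** * Binary digits of the indices of the sequence *)

Lemma bits_supported (m p : nat) : (p < 2 ^ m)%N -> supported m (bits p).
Proof.
move=> pm i mi; rewrite /bits divn_small // (leq_trans pm) //.
by rewrite leq_exp2l.
Qed.

Lemma bitsS (p i : nat) : bits p i.+1 = bits p./2 i.
Proof. by rewrite /bits expnS divnMA divn2. Qed.

Lemma bits0 (p : nat) : bits p 0 = (odd p)%:R.
Proof. by rewrite /bits divn1. Qed.

Lemma bits_inj (m p q : nat) : (p < 2 ^ m)%N -> (q < 2 ^ m)%N ->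
  (forall i, (i < m)%N -> bits p i = bits q i) -> p = q.
Proof.
elim: m p q => [|m IH] p q; first by rewrite expn0; case: p q => [|?] [].
rewrite expnS => pm qm pq.
have odd_pq : odd p = odd q.
  by have := pq 0%N isT; rewrite !bits0; case: (odd p); case: (odd q).
have half_pq : p./2 = q./2.
  by apply: IH => [||i im]; [lia | lia | rewrite -!bitsS pq].
by rewrite -(odd_double_half p) -(odd_double_half q) odd_pq half_pq.
Qed.

Lemma bits_onto (m : nat) (v : infvec) : supported m v ->
  exists2 p, (p < 2 ^ m)%N & bits p = v.
Proof.
elim: m v => [|m IH] v v_supp.
  exists 0%N => //; apply/funext => i; rewrite v_supp //.
  exact: (@bits_supported 0).
have [|p pm pv] := IH (fun i => v i.+1); first by move=> i mi; apply: v_supp.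
have v0 := F2_lt2 (v 0%N).
have odd_v0 : odd (v 0%N + p.*2) = (v 0%N == 1).
  rewrite oddD odd_double addbF; move: (v 0%N) v0.
  by case=> [[|[|?]] ?].
exists (v 0%N + p.*2)%N; first by rewrite expnS; move: v0 => /=; lia.
apply/funext => -[|i].
  rewrite bits0 odd_v0; have [-> //|/eqP v1] := eqVneq (v 0%N) 1.
  by apply/esym/eqP; apply: contra_notT v1 => /eqP; apply: F2_neq0.
rewrite bitsS -[in RHS](congr1 (@^~ i) pv); congr bits.
by move: v0 => /=; lia.
Qed.

Lemma bits_block (m k p i : nat) : (p < 2 ^ m)%N ->
  bits (k * 2 ^ m + p) i = if (i < m)%N then bits p i else bits k (i - m)%N.
Proof.
move=> pm; rewrite /bits; case: ltnP => im.
  rewrite -(subnKC im) expnD [(2 ^ i.+1)%N]expnS; set d := (m - i.+1)%N.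
  by rewrite mulnAC mulnA divnMDl ?expn_gt0 // oddD !oddM andbF.
rewrite -{1}(subnKC im) expnD divnMA divnMDl ?expn_gt0 //.
by rewrite [(p %/ _)%N]divn_small // addn0.
Qed.

(** * The net property and regularity *)

Lemma net_volume (R : realType) (m c0 c1 : nat) :
  ((2 ^+ c0)^-1 * (2 ^+ c1)^-1 = 2 ^ (0%:Z - m%:Z) :> R) <-> (c0 + c1 = m)%N.
Proof.
rewrite sub0r -exprnN -invfM -exprD; split=> [/invr_inj | -> //].
by apply: ieexprIn => //; rewrite gt_eqF // ltr1n.
Qed.

(** The cell at the origin contains exactly one point of the first block. Index 0 gives such a
    point, and so does the index whose digit vector is the kernel vector [v]; hence [v] is zero. *)
Lemma net_regular (R : realType) (B C : infmx) :
  generates_digital_sequence R 0 [tuple B; C] -> regular_pair B C.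
Proof.
case=> _ net c1 c2 v v_supp Bv0 Cv0.
have [_] := net 0%N (c1 + c2)%N; set m := (c1 + c2)%N in v_supp *.
pose c (j : 'I_2) := if j == ord0 then c1 else c2.
move=> /(_ c (fun=> 0%N)); rewrite !big_ord_recl big_ord0 mulr1.
move=> /(_ (fun j => expn_gt0 2 (c j))) /(_ ((net_volume R m c1 c2).2 erefl)).
move/eqP/cards1P => [q Eq].
have in_cell (p : 'I_(2 ^ m)) :
    (forall i, (i < c1)%N -> infmulv B (bits p) i = 0) ->
    (forall i, (i < c2)%N -> infmulv C (bits p) i = 0) -> p = q.
  move=> Bp Cp; apply/set1P; rewrite -Eq inE; apply/forallP => j.
  rewrite /digital_digits mul0n add0n trunc_interval.
    apply/eqP/digits_nat_eq0; rewrite (tnth_nth B) /c.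
    by case: j => [[|[|//]] jlt]; [exact: Bp | exact: Cp].
  by rewrite /c /m; case: ifP; rewrite ?leq_addr ?leq_addl.
have [p pm pv] := bits_onto v_supp.
have m0 : (0 < 2 ^ m)%N by rewrite expn_gt0.
have bits00 : bits 0 = fun=> 0 :> 'F_2.
  by apply/funext => i; apply: (@bits_supported 0).
have A0 (A : infmx) i : infmulv A (fun=> 0) i = 0.
  by rewrite (@infmulv_supported 0) ?big_ord0.
have p0 : Ordinal pm = Ordinal m0.
  transitivity q; last apply/esym; apply: in_cell => i /=; rewrite ?pv ?bits00.
  - exact: Bv0.
  - exact: Cv0.
  - by rewrite A0.
  - by rewrite A0.
by move: p0 => [p0] k; rewrite -pv p0 bits00.
Qed.

(** Regularity makes the map [f] from a block to pairs of cell numbers injective. Both sides have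
    2^m elements, so every cell is hit exactly once. *)
Lemma regular_net (R : realType) (B C : infmx) :
  regular_pair B C -> generates_digital_sequence R 0 [tuple B; C].
Proof.
move=> BC; split=> // k m; split=> [p j|c a a_lt]; first exact: trunc_bounds.
rewrite !big_ord_recl big_ord0 mulr1 => /net_volume.
set j0 : 'I_2 := ord0; set j1 : 'I_2 := lift _ _ => cm.
pose z (p : 'I_(2 ^ m)) := bits (k * 2 ^ m + p).
pose f p := (Ordinal (digits_nat_lt (c j0) (infmulv B (z p))),
             Ordinal (digits_nat_lt (c j1) (infmulv C (z p)))).
have z_supp p : exists n, supported n (z p).
  exists (k * 2 ^ m + p)%N; apply: bits_supported; exact: ltn_expl.
have f_inj : injective f.
  move=> p q [/digits_nat_inj Bpq /digits_nat_inj Cpq]; apply/val_inj => /=.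
  have [n n_supp] : exists n, supported n (z p) /\ supported n (z q).
    have [n1 s1] := z_supp p; have [n2 s2] := z_supp q.
    by exists (maxn n1 n2); split=> i; rewrite geq_max => /andP[? ?];
      [exact: s1 | exact: s2].
  pose v i := z p i + z q i.
  have ker (A : infmx) i : infmulv A (z p) i = infmulv A (z q) i ->
      infmulv A v i = 0.
    by move=> Apq; rewrite (infmulvD A n_supp.1 n_supp.2) Apq F2_addrr.
  have v0 : forall i, v i = 0.
    apply: (BC (c j0) (c j1)).
    (* From position [m] on both indices have the digits of [k], which cancel in the sum. *)
    - by rewrite cm => i mi; rewrite /v /z !bits_block // ltnNge mi F2_addrr.
    - by move=> i ic; apply/ker/Bpq.
    - by move=> i ic; apply/ker/Cpq.
  apply: (@bits_inj m) => // i im; apply/eqP.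
  rewrite -subr_eq0 F2_oppr; apply/eqP.
  by have := v0 i; rewrite /v /z !bits_block // im.
have [|g fK gK] := inj_card_bij f_inj.
  by rewrite card_prod !card_ord -expnD cm.
rewrite -[RHS](cards1 (g (Ordinal (a_lt j0), Ordinal (a_lt j1)))); apply: eq_card => p.
rewrite !inE -(can2_eq fK gK) -[RHS]/(_ && _).
apply/forallP/andP => [cell | [/eqP[cell0] /eqP[cell1]] j].
  by split; [have := cell j0 | have := cell j1];
     rewrite trunc_interval // -cm ?leq_addr ?leq_addl.
have cj : (c j <= m)%N.
  rewrite -cm; case: j => -[|[|//]] jlt.
    by rewrite (_ : Ordinal jlt = j0) ?leq_addr //; apply/val_inj.
  by rewrite (_ : Ordinal jlt = j1) ?leq_addl //; apply/val_inj.
rewrite trunc_interval //; apply/eqP; case: j {cj} => -[|[|//]] jlt.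
  by rewrite (_ : Ordinal jlt = j0) //; apply/val_inj.
by rewrite (_ : Ordinal jlt = j1) //; apply/val_inj.
Qed.

Theorem theorem1p2 (R : realType) (B C : infmx) :
  generates_digital_sequence R 0 [tuple B; C] <->
  exists L1 L2 U : infmx,
    [/\ lower_infty L1, lower_infty L2, upper_infty U,
        B = infmul L1 U & C = infmul (infmul L2 pascal_infty) U].
Proof.
split=> [/net_regular | [L1 [L2 [U [L1l L2l Uu -> ->]]]]].
  exact: factors_of_regular.
exact/regular_net/regular_of_factors.
Qed.
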